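(* Let $\phi$ be a CNF formula over a finite set $X$ of Boolean variables, let $(T, r, \gamma, \pi)$ be a project-join tree of $\phi$, and let $W = \prod_{x \in X} W_x$ be a literal-weight function over $X$. Then the $W$-valuation of the root satisfies $f^W_r(\emptyset) = W(\phi)$, where $W(\phi)$ is the weighted model count of $\phi$ with respect to $W$.
   Context: Truth assignments to a set $X$ of Boolean variables are identified with subsets $\tau \in 2^X$ (the variables set to true). A pseudo-Boolean function over $X$ is a function $f : 2^X \to \mathbb{R}$. Product: for $f : 2^X \to \mathbb{R}$ and $g : 2^Y \to \mathbb{R}$, $f \cdot g : 2^{X \cup Y} \to \mathbb{R}$ is $(f\cdot g)(\tau) = f(\tau \cap X)\, g(\tau \cap Y)$. The empty product is the constant $1$ on $2^\emptyset$. Projection: for $f : 2^X \to \mathbb{R}$ and $x \in X$, $\sum_x f : 2^{X \setminus \{x\}} \to \mathbb{R}$ is $(\sum_x f)(\tau) = f(\tau) + f(\tau \cup \{x\})$. Projections commute; for $Y=\{x_1,\dots,x_k\}\subseteq X$, $\sum_Y f = \sum_{x_1} \cdots \sum_{x_k} f$, and $\sum_\emptyset f = f$. A CNF formula $\phi$ over $X$ is a finite set of clauses; each clause $c$ has a set of variables $\mathrm{vars}(c) \subseteq X$ and is identified with the function $2^{\mathrm{vars}(c)} \to \{0,1\}$ with value $1$ exactly on assignments satisfying $c$. $\phi$ is identified with the Boolean function $\prod_{c \in \phi} c$ (viewed as a function on $2^X$, ignoring variables not occurring in it). A literal-weight function over $X$ is $W = \prod_{x \in X} W_x : 2^X \to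 \mathbb{R}$ with $W_x : 2^{\{x\}} \to \mathbb{R}$ for each $x$. The weighted model count is $W(\phi) = \sum_{\tau \in 2^X} \phi(\tau) W(\tau)$. A project-join tree of $\phi$ is a tuple $(T, r, \gamma, \pi)$ where $T$ is a finite tree with root $r$, $\mathcal{V}(T)$ is its node set, $\mathcal{L}(T)$ its set of leaves (nodes with no children), $\gamma : \mathcal{L}(T) \to \phi$ is a bijection, and $\pi : \mathcal{V}(T) \setminus \mathcal{L}(T) \to 2^X$ labels internal nodes, such that: (1) the sets $\pi(n)$, $n$ ranging over internal nodes, form a partition of $X$ (pairwise disjoint for distinct nodes, with union $X$; some may be empty); (2) for each internal node $n$, each $x \in \pi(n)$, and each clause $c \in \phi$ in which $x$ appears, the leaf $\gamma^{-1}(c)$ is a descendant of $n$. $\mathcal{C}(n)$ denotes the set of children of $n$. The $W$-valuation $f^W_n$ of a node $n$ is defined recursively: $f^W_n = \gamma(n)$ if $n$ is a leaf, and $f^W_n = \sum_{\pi(n)} \left( \prod_{o \in \mathcal{C}(n)} f^W_o \cdot \prod_{x \in \pi(n)} W_x \right)$ if $n$ is internal. *)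

(* Defs.v *)
From HB Require Import structures.
From mathcomp Require Import all_boot all_order all_algebra.
From mathcomp Require Import reals.

Set Implicit Arguments.
Unset Strict Implicit.
Unset Printing Implicit Defensive.

Import GRing.Theory.
Local Open Scope ring_scope.

(* The Boolean variables are the elements of a finite type X.  An element of
   2^A, for A a set of variables, is the set of the variables of A that are
   true. *)
Definition assignment (X : finType) (A : {set X}) : Type :=
  {t : {set X} | t \subset A}.

Definition restrict (X : finType) (A t : {set X}) : assignment A :=
  exist _ (t :&: A) (subsetIr t A).

Definition empty_assignment (X : finType) (A : {set X}) : assignment A :=
  exist _ set0 (sub0set A).

(* A pseudo-Boolean function carries the set of variables it is defined over,
   so that products of families with varying domains can be formed. *)
Record pbfun (R : realType) (X : finType) := PBFun {
  scope : {set X};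
  pbval :> assignment scope -> R
}.

Arguments PBFun {R X} scope pbval.

Definition pbone (R : realType) (X : finType) : pbfun R X :=
  PBFun set0 (fun=> 1).

Definition pbmul (R : realType) (X : finType) (f g : pbfun R X) : pbfun R X :=
  PBFun (scope f :|: scope g)
    (fun t => f (restrict (scope f) (val t)) * g (restrict (scope g) (val t))).

(* When x \in scope f, the intersections with scope f made by restrict are
   identities; the value for x \notin scope f is irrelevant. *)
Definition pbproj (R : realType) (X : finType) (x : X) (f : pbfun R X) :
    pbfun R X :=
  PBFun (scope f :\ x)
    (fun t => f (restrict (scope f) (val t))
            + f (restrict (scope f) (x |: val t))).

Definition pbprojs (R : realType) (X : finType) (Y : {set X})
    (f : pbfun R X) : pbfun R X :=
  foldr (@pbproj R X) f (enum Y).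

(* f viewed as a function on 2^X, ignoring the variables outside its scope. *)
Definition pbextend (R : realType) (X : finType) (f : pbfun R X)
    (t : {set X}) : R :=
  f (restrict (scope f) t).

(* The literal (x, true) is x, and (x, false) is its negation. *)
Definition clause (X : finType) : finType := {set X * bool}.

Definition cnf (X : finType) : finType := {set clause X}.

Definition vars (X : finType) (c : clause X) : {set X} :=
  [set l.1 | l in c].

Definition satisfies (X : finType) (t : {set X}) (c : clause X) : bool :=
  [exists l in c, (l.1 \in t) == l.2].

Definition clause_fun (R : realType) (X : finType) (c : clause X) :
    pbfun R X :=
  PBFun (vars c) (fun t => (satisfies (val t) c)%:R).

Definition cnf_fun (R : realType) (X : finType) (phi : cnf X) : pbfun R X :=
  \big[@pbmul R X/@pbone R X]_(c in phi) clause_fun R c.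

(* The factors W_x : 2^{x} -> R of a literal-weight function. *)
Definition literal_weights (R : realType) (X : finType) : Type :=
  forall x : X, assignment [set x] -> R.

Definition weight_prod (R : realType) (X : finType)
    (W : literal_weights R X) (A : {set X}) : pbfun R X :=
  \big[@pbmul R X/@pbone R X]_(x in A) PBFun [set x] (W x).

Definition weight_fun (R : realType) (X : finType)
    (W : literal_weights R X) : pbfun R X :=
  weight_prod W [set: X].

Definition weighted_model_count (R : realType) (X : finType)
    (W : literal_weights R X) (phi : cnf X) : R :=
  \sum_(t : {set X})
     pbextend (cnf_fun R phi) t * pbextend (weight_fun W) t.

(* A finite rooted tree is given by its node type T, the set C n of children
   of each node n, and its root r. *)
Definition child (T : finType) (C : T -> {set T}) : rel T :=
  fun n o => o \in C n.

Record rooted_tree (T : finType) (C : T -> {set T}) (r : T) : Prop :=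
  RootedTree {
    root_no_parent : forall n, r \notin C n;
    parent_unique : forall n m o, o \in C n -> o \in C m -> n = m;
    root_reaches : forall n, connect (child C) r n
  }.

Definition leaf (T : finType) (C : T -> {set T}) (n : T) : bool :=
  C n == set0.

(* d is a descendant of n.  A node counts as its own descendant here, which
   is harmless below, where n is internal and d is a leaf. *)
Definition descendant (T : finType) (C : T -> {set T}) (n d : T) : bool :=
  connect (child C) n d.

(* gamma is only meaningful on leaves, and pi on internal nodes. *)
Record project_join_tree (X : finType) (phi : cnf X) (T : finType)
    (C : T -> {set T}) (r : T) (gamma : T -> clause X) (pi : T -> {set X}) :
    Prop := ProjectJoinTree {
  pjt_tree : rooted_tree C r;
  pjt_gamma_inj : {in leaf C &, injective gamma};
  pjt_gamma_im : [set gamma l | l in leaf C] = phi;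
  pjt_pi_disjoint : forall n m : T, ~~ leaf C n -> ~~ leaf C m -> n != m ->
    [disjoint pi n & pi m];
  pjt_pi_cover : \bigcup_(n | ~~ leaf C n) pi n = [set: X];
  pjt_desc : forall (n : T) (x : X) (c : clause X) (l : T),
    ~~ leaf C n -> x \in pi n -> c \in phi -> x \in vars c ->
    leaf C l -> gamma l = c -> descendant C n l
}.

(* Recursion over the tree with fuel k.  Fuel #|T| suffices: valuationE below
   is the recursive equation that the valuation satisfies on a rooted tree. *)
Fixpoint valuation_rec (R : realType) (X : finType) (T : finType)
    (C : T -> {set T}) (gamma : T -> clause X) (pi : T -> {set X})
    (W : literal_weights R X) (k : nat) (n : T) {struct k} : pbfun R X :=
  if leaf C n then clause_fun R (gamma n) else
  if k is k'.+1 then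
    pbprojs (pi n)
      (pbmul (\big[@pbmul R X/@pbone R X]_(o in C n)
                valuation_rec C gamma pi W k' o)
             (weight_prod W (pi n)))
  else pbone R X.

Definition valuation (R : realType) (X : finType) (T : finType)
    (C : T -> {set T}) (gamma : T -> clause X) (pi : T -> {set X})
    (W : literal_weights R X) (n : T) : pbfun R X :=
  valuation_rec C gamma pi W #|T| n.

Lemma rooted_tree_acyclic (T : finType) (C : T -> {set T}) (r n o : T) :
  rooted_tree C r -> o \in C n -> ~~ connect (child C) o n.
Proof.
move=> [rootP parP reach] Cno; apply/negP => con.
pose S m := connect (child C) n m && connect (child C) m n.
have parS m : S m -> exists2 p, S p & m \in C p.
  case/andP=> /connectP[p]; case/lastP: p => [|p z] /=.
    move=> _ -> _; case/connectP: con => q.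
    case/lastP: q => [|q z] /=.
      move=> _ eon; exists n; first by rewrite /S !connect0.
      by rewrite {1}eon.
    rewrite rcons_path last_rcons => /andP[pq zlast] ez; rewrite -ez in zlast *.
    exists (last o q); last by [].
    apply/andP; split; last exact: connect1.
    apply: (@connect_trans _ _ o); first exact: connect1.
    by apply/connectP; exists q.
  rewrite rcons_path last_rcons => /andP[pp zlast] -> czn.
  exists (last n p); last by [].
  apply/andP; split; first by apply/connectP; exists p.
  by apply: connect_trans czn; apply: connect1.
have Sr p : path (child C) r p -> ~~ S (last r p).
  elim/last_ind: p => [_|p z IHp] /=.
    by apply/negP => /parS[q _]; apply/negP; apply: rootP.
  rewrite rcons_path last_rcons => /andP[/IHp nS Cz].
  by apply/negP => /parS[q Sq Cqz]; case/negP: nS; rewrite (parP _ _ _ Cz Cqz).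
case/connectP: (reach n) => p /Sr nS en; case/negP: nS.
by rewrite -en /S connect0.
Qed.

Lemma valuationE (R : realType) (X : finType) (T : finType)
    (C : T -> {set T}) (r : T) (gamma : T -> clause X) (pi : T -> {set X})
    (W : literal_weights R X) (n : T) :
  rooted_tree C r ->
  valuation C gamma pi W n =
    if leaf C n then clause_fun R (gamma n)
    else pbprojs (pi n)
           (pbmul (\big[@pbmul R X/@pbone R X]_(o in C n)
                     valuation C gamma pi W o)
                  (weight_prod W (pi n))).
Proof.
move=> treeC; pose D m := [set d | connect (child C) m d].
have Dlt m o : o \in C m -> (#|D o| < #|D m|)%N.
  move=> Cmo; apply: proper_card; apply/properP; split.
    apply/subsetP => d; rewrite !inE; apply: connect_trans.
    exact: connect1.
  exists m; rewrite inE ?connect0 //.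
  exact: rooted_tree_acyclic treeC Cmo.
have fuel k k' m : (#|D m| <= k)%N -> (#|D m| <= k')%N ->
    valuation_rec C gamma pi W k m = valuation_rec C gamma pi W k' m.
  elim: k k' m => [|k IHk] [|k'] m //=.
  - by rewrite leqn0 cards_eq0 => /eqP/setP/(_ m); rewrite !inE connect0.
  - by move=> _; rewrite leqn0 cards_eq0 => /eqP/setP/(_ m); rewrite !inE connect0.
  move=> le1 le2; case: ifP => // _; congr (pbprojs _ (pbmul _ _)).
  apply: eq_bigr => o /Dlt lt; apply: IHk; rewrite -ltnS.
    exact: leq_trans le1.
  exact: leq_trans le2.
rewrite /valuation (fuel #|T| #|T|.+1) ?max_card //=.
exact: leq_trans (max_card _) _.
Qed.

(* Main.v *)
(* Extend every pseudo-Boolean function to all of 2^X. Products then become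
   pointwise, and projecting out Y sums a function over the assignments
   that agree outside Y. Call a set S of nodes downward closed if it
   contains the descendants of its members. For such S, let V(S) (summed S
   below) be the product of the clauses at the leaves in S and of the
   weights of the variables projected in S, with those variables summed
   out. If S and S' are disjoint and downward closed, no clause at a leaf
   in S mentions a variable projected in S', so distributivity gives V(S)
   V(S') = V(S u S'). Hence, by induction on the tree, the valuation of n
   is V(descendants of n), which at the root is the weighted model count. *)
Require Import Defs.
From HB Require Import structures.
From mathcomp Require Import all_boot all_order all_algebra.
From mathcomp Require Import reals.

Set Implicit Arguments.
Unset Strict Implicit.
Unset Printing Implicit Defensive.

Import GRing.Theory.
Local Open Scope ring_scope.

Lemma prod_setU_disjoint (R : comPzSemiRingType) (I : finType) (A B : {set I})
    (P : pred I) (F : I -> R) : [disjoint A & B] ->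
  \prod_(i in A :|: B | P i) F i =
  (\prod_(i in A | P i) F i) * (\prod_(i in B | P i) F i).
Proof.
move=> dAB; rewrite (big_setIDcond _ (A :|: B) A) setUK setDUl setDv set0U.
by rewrite (setDidPl _) // disjoint_sym.
Qed.

(** * Summing variables out of functions on all of 2^X *)

Section SumOut.
Variables (R : comPzSemiRingType) (X : finType).
Implicit Types (F G : {set X} -> R) (Y Z t u v : {set X}).

Definition sumout Y F t : R := \sum_(u : {set X} | u :\: Y == t :\: Y) F u.

Definition indep Y F := forall u v, u :\: Y = v :\: Y -> F u = F v.

Lemma eq_sumout Y F G t : F =1 G -> sumout Y F t = sumout Y G t.
Proof. by move=> eFG; apply: eq_bigr => u _. Qed.

Lemma sumout0 F t : sumout set0 F t = F t.
Proof. by rewrite /sumout (big_pred1 t) // => u; rewrite !setD0. Qed.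

Lemma sumoutT F t : sumout [set: X] F t = \sum_u F u.
Proof. by apply: eq_bigl => u; rewrite !setDT eqxx. Qed.

Lemma sumout1 x F t : sumout [set x] F t = F (t :\ x) + F (x |: t).
Proof.
have neq : x |: t != t :\ x.
  by apply/eqP => /setP/(_ x); rewrite !inE eqxx.
rewrite /sumout (bigD1 (t :\ x)) /=; last first.
  by apply/eqP/setP => y; rewrite !inE; case: (y == x).
congr (_ + _); apply: big_pred1 => u; apply/andP/eqP => [[/eqP eu nu]|->].
  have xu : x \in u.
    apply: contraNT nu => xNu; rewrite -eu; apply/eqP/setP => y; rewrite !inE.
    by case: eqP => // ->; apply: negbTE.
  apply/setP => y; move/setP/(_ y): eu; rewrite !inE.
  by case: eqP => [->|].
split=> //; apply/eqP/setP => y; by rewrite !inE; case: (y == x).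
Qed.

Lemma sumoutU Y Z F t :
  [disjoint Y & Z] -> sumout (Y :|: Z) F t = sumout Y (sumout Z F) t.
Proof.
move=> dYZ; have dis y : ~~ ((y \in Y) && (y \in Z)).
  by apply/andP=> -[/(disjointFr dYZ)->].
(* Each [u] is grouped under the intermediate assignment that agrees with [u] on [Y] and with [t]
   elsewhere; [Y] and [Z] being disjoint, it is the only admissible [v] agreeing with [u] off
   [Z]. *)
rewrite /sumout (partition_big (fun u => t :\: Y :|: u :&: Y)
  (fun v => v :\: Y == t :\: Y)) /=; last first.
  move=> u _; apply/eqP/setP => y; rewrite !inE.
  by do !case: (_ \in _).
apply: eq_bigr => v /eqP/setP ev; apply: eq_bigl => u.
apply/andP/eqP => [[/eqP/setP eu /eqP/setP euv]|/setP euv].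
  apply/setP => y; move: (eu y) (euv y) (dis y) (ev y); rewrite !inE.
  by do !case: (_ \in _).
split; apply/eqP/setP => y; move: (euv y) (dis y) (ev y); rewrite !inE;
  by do !case: (_ \in _).
Qed.

Lemma indep_prod (I : Type) (r : seq I) (P : pred I) (F : I -> {set X} -> R) Y :
  (forall i, P i -> indep Y (F i)) ->
  indep Y (fun t => \prod_(i <- r | P i) F i t).
Proof. by move=> iF u v euv; apply: eq_bigr => i Pi; apply: iF. Qed.

Lemma indepM Y F G : indep Y F -> indep Y G -> indep Y (fun t => F t * G t).
Proof. by move=> iF iG u v euv; rewrite (iF u v) // (iG u v). Qed.

Lemma sumout_indepl Y F G t :
  indep Y F -> sumout Y (fun u => F u * G u) t = F t * sumout Y G t.
Proof.
by move=> iF; rewrite /sumout big_distrr; apply: eq_bigr => u /eqP/iF->.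
Qed.

Lemma indep_sumout Y Z F : indep Y F -> indep Y (sumout Z F).
Proof.
(* [h w s] is [s] on [Z] and [w] elsewhere. So [h u] carries the assignments matching [v] off [Z]
   bijectively onto those matching [u], with inverse [h v], and changes them only inside [Y]. *)
move=> iF u v /setP euv; pose h w s : {set X} := w :\: Z :|: s :&: Z.
have hZ w s : h w s :\: Z == w :\: Z.
  by apply/eqP/setP => y; rewrite !inE; do !case: (_ \in _).
have hK w w' s : s :\: Z = w :\: Z -> h w (h w' s) = s.
  move/setP => es; apply/setP => y; move: (es y); rewrite !inE.
  by do !case: (_ \in _).
rewrite /sumout (reindex_onto (h u) (h v)) /=; last by move=> s /eqP; apply: hK.
apply: eq_big => [s|s /andP[_ /eqP <-]].
  rewrite hZ /=; apply/eqP/eqP => [<-|]; last exact: hK.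
  exact/eqP.
apply: iF; apply/setP => y; move: (euv y); rewrite !inE.
by do !case: (_ \in _).
Qed.

(** In the iterated sum, [F] leaves the inner sum because it ignores [Z]; then [sumout Z G] leaves
    the outer sum because it inherits from [G] that it ignores [Y]. *)
Lemma sumoutM Y Z F G t :
  [disjoint Y & Z] -> indep Z F -> indep Y G ->
  sumout Y F t * sumout Z G t = sumout (Y :|: Z) (fun u => F u * G u) t.
Proof.
move=> dYZ iF iG; rewrite sumoutU //.
rewrite (eq_sumout _ _ (fun u => sumout_indepl _ _ iF)).
rewrite (eq_sumout _ _ (fun u => mulrC (F u) _)).
by rewrite sumout_indepl ?(mulrC (sumout Z _ _)) //; apply: indep_sumout.
Qed.
End SumOut.

(** * Pseudo-Boolean operations after extension to 2^X *)

Section Extension.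
Variables (R : realType) (X : finType).
Implicit Types (f g : pbfun R X) (A Y t : {set X}).

Lemma eq_restrict A t u : t :&: A = u :&: A -> restrict A t = restrict A u.
Proof. by move=> e; apply: val_inj. Qed.

Lemma pbextend_mul f g t :
  pbextend (pbmul f g) t = pbextend f t * pbextend g t.
Proof.
rewrite /pbextend /=; congr (f _ * g _); apply: eq_restrict;
  apply/setP => y; rewrite !inE; by do !case: (_ \in _).
Qed.

Lemma pbextend_prod (I : Type) (r : seq I) (P : pred I) (F : I -> pbfun R X) t :
  pbextend (\big[@pbmul R X/@pbone R X]_(i <- r | P i) F i) t =
  \prod_(i <- r | P i) pbextend (F i) t.
Proof.
by apply: (big_morph (fun f => pbextend f t)) => [f g|//]; apply: pbextend_mul.
Qed.

(** For [x] outside [scope f], both sides count the same value of [f] twice. *)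
Lemma pbextend_proj x f t :
  pbextend (pbproj x f) t = sumout [set x] (pbextend f) t.
Proof.
rewrite sumout1 /pbextend /=; congr (f _ + f _); apply: eq_restrict;
  apply/setP => y; rewrite !inE; case: (y == x); by do !case: (_ \in _).
Qed.

Lemma pbextend_projs Y f t :
  pbextend (pbprojs Y f) t = sumout Y (pbextend f) t.
Proof.
rewrite -[in RHS](set_enum Y) /pbprojs.
elim: (enum Y) (enum_uniq Y) t => [_ t|x s IHs].
  by rewrite set_nil sumout0.
rewrite cons_uniq => /andP[xNs us] t.
rewrite set_cons sumoutU; last by rewrite disjoints1 inE.
rewrite -[foldr _ _ _]/(pbproj x (foldr _ _ _)) pbextend_proj.
by apply: eq_sumout => u; apply: IHs.
Qed.

Lemma indep_pbextend Y f : [disjoint scope f & Y] -> indep Y (pbextend f).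
Proof.
move=> dfY u v /setP euv; congr (f _); apply: eq_restrict.
apply/setP => y; move: (euv y); rewrite !inE.
by case: (boolP (y \in scope f)) => [/(disjointFr dfY)->|_]; rewrite ?andbF ?andbT.
Qed.

End Extension.

(** * Descendants and downward closed sets in a rooted tree *)

Section Tree.
Variables (T : finType) (C : T -> {set T}) (r : T).
Hypothesis treeC : rooted_tree C r.

Lemma connect_parent a m d :
  d \in C m -> connect (child C) a d -> a = d \/ connect (child C) a m.
Proof.
move=> Cmd /connectP[p]; case/lastP: p => [|p z]; first by left.
rewrite rcons_path last_rcons => /andP[pp zlast] ed; right.
rewrite -ed in zlast; rewrite (parent_unique treeC Cmd zlast).
by apply/connectP; exists p.
Qed.

(** Climb from [d] to [o], one parent at a time. The node [o'] stays an ancestor: if it were passed,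
    its parent [n] would lie below [o], a cycle. Once at [o], either [o' = o] or [n] lies below
    [o'], again a cycle. *)
Lemma child_descendant_unique n o o' d : o \in C n -> o' \in C n ->
  connect (child C) o d -> connect (child C) o' d -> o = o'.
Proof.
move=> Co Co' /connectP[p]; elim/last_ind: p d => [d _ ->|p z IHp d] /=.
  case/(connect_parent Co) => // con.
  by case/negP: (rooted_tree_acyclic treeC Co').
rewrite rcons_path last_rcons => /andP[pp zlast] ->.
case/(connect_parent zlast) => [eo'|]; last exact: IHp.
case/negP: (rooted_tree_acyclic treeC Co).
rewrite (parent_unique treeC Co' (_ : o' \in C (last o p))) ?eo' //.
by apply/connectP; exists p.
Qed.

Definition descendants n : {set T} := [set d | connect (child C) n d].

Definition down_closed (S : {set T}) :=
  forall n d, n \in S -> connect (child C) n d -> d \in S.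

Lemma down_closed_descendants n : down_closed (descendants n).
Proof. by move=> m d; rewrite !inE; apply: connect_trans. Qed.

Lemma down_closedU S S' :
  down_closed S -> down_closed S' -> down_closed (S :|: S').
Proof.
move=> cS cS' n d; rewrite !inE => /orP[Sn|S'n] con; first by rewrite (cS n).
by rewrite (cS' n) ?orbT.
Qed.

Lemma down_closed_bigcup (I : Type) (s : seq I) (S : I -> {set T}) :
  (forall i, down_closed (S i)) -> down_closed (\bigcup_(i <- s) S i).
Proof.
move=> cS; apply: big_ind => // [n d|]; first by rewrite inE.
exact: down_closedU.
Qed.

(** The union runs over a list so that subtrees can be split off one by one by induction. *)
Lemma descendantsE n :
  descendants n = n |: \bigcup_(o <- enum (C n)) descendants o.
Proof.
rewrite big_enum; apply/setP => d; rewrite !inE.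
apply/idP/orP => [/connectP[[|o p] /= pp ->]|[/eqP->|/bigcupP[o Co]]].
- by left.
- case/andP: pp => Co pp; right; apply/bigcupP; exists o => //.
  by rewrite inE; apply/connectP; exists p.
- exact: connect0.
by rewrite inE; apply/connect_trans/connect1.
Qed.

Lemma notin_child_descendants n :
  n \notin \bigcup_(o <- enum (C n)) descendants o.
Proof.
rewrite big_enum; apply/bigcupP => -[o Co]; rewrite inE.
exact/negP/(rooted_tree_acyclic treeC).
Qed.

Lemma disjoint_child_descendants n o s :
  o \in C n -> {subset s <= C n} -> o \notin s ->
  [disjoint descendants o & \bigcup_(o' <- s) descendants o'].
Proof.
move=> Co sC; elim: s sC => [|o' s IHs] sC.
  by rewrite big_nil disjoint_sym -setI_eq0 set0I.
rewrite inE negb_or => /andP[oo' os]; rewrite big_cons disjoint_sym.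
rewrite -setI_eq0 setIUl setU_eq0 !setI_eq0 ![[disjoint _ & descendants o]]disjoint_sym.
rewrite IHs ?andbT //; last by move=> z zs; apply: sC; rewrite inE zs orbT.
rewrite disjoint_subset; apply/subsetP => d; rewrite !inE => od.
apply: contra oo' => o'd; apply/eqP.
by apply: (child_descendant_unique Co (sC o' _) od o'd); rewrite inE eqxx.
Qed.

End Tree.

(** * Valuations as sums over descendants *)

Section Valuation.
Variables (R : realType) (X : finType) (phi : cnf X).
Variables (T : finType) (C : T -> {set T}) (r : T).
Variables (gamma : T -> clause X) (pi : T -> {set X}).
Variable W : literal_weights R X.
Hypothesis pjt : project_join_tree phi C r gamma pi.
Implicit Types (S : {set T}) (t : {set X}).

Let treeC : rooted_tree C r := pjt_tree pjt.

Definition projected S : {set X} := \bigcup_(n in S | ~~ leaf C n) pi n.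

Definition weights_at (A t : {set X}) : R :=
  \prod_(x in A) pbextend (PBFun [set x] (@W x)) t.

Definition clauses_at S t : R :=
  \prod_(l in S | leaf C l) pbextend (clause_fun R (gamma l)) t.

Definition factors S t : R := clauses_at S t * weights_at (projected S) t.

Definition summed S : {set X} -> R := sumout (projected S) (factors S).

Lemma projectedP S x :
  reflect (exists n, [/\ n \in S, ~~ leaf C n & x \in pi n]) (x \in projected S).
Proof.
apply: (iffP bigcupP) => [[n /andP[]]|[n []]]; first by exists n.
by move=> Sn In xn; exists n; rewrite ?Sn.
Qed.

Lemma disjoint_projected S S' :
  [disjoint S & S'] -> [disjoint projected S & projected S'].
Proof.
move=> dS; rewrite disjoint_subset; apply/subsetP => x.
case/projectedP=> n [Sn In xn]; rewrite inE; apply/projectedP => -[m [Sm Im xm]].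
have nm : n != m by apply: contraTneq Sn => ->; rewrite (disjointFl dS).
by move: (disjointFr (pjt_pi_disjoint pjt In Im nm) xn); rewrite xm.
Qed.

Lemma projectedU S S' : projected (S :|: S') = projected S :|: projected S'.
Proof.
apply/setP => x; rewrite inE; apply/projectedP/orP.
  by case=> n []; rewrite inE => /orP[]; [left|right]; apply/projectedP; exists n.
by case=> /projectedP[n [Sn In xn]]; exists n; rewrite inE Sn ?orbT.
Qed.

Lemma indep_weights_at (A Y : {set X}) : [disjoint A & Y] -> indep Y (weights_at A).
Proof.
move=> dAY; apply: indep_prod => x xA; apply: indep_pbextend.
by rewrite /= disjoints1 (disjointFr dAY).
Qed.

(** If the clause at a leaf [l] of [S] mentioned a variable projected at a node of [S'], then [l]
    would descend from that node and so belong to [S'] as well. *)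
Lemma indep_clauses_at S S' :
  down_closed C S' -> [disjoint S & S'] -> indep (projected S') (clauses_at S).
Proof.
move=> cS' dS; apply: indep_prod => l /andP[Sl Ll]; apply: indep_pbextend.
rewrite /= disjoint_subset; apply/subsetP => x xl; rewrite inE.
apply/projectedP => -[n [Sn In xn]].
have phil : gamma l \in phi.
  by rewrite -(pjt_gamma_im pjt); apply: imset_f.
have := cS' n l Sn (pjt_desc pjt In xn phil xl Ll erefl).
by rewrite (disjointFr dS).
Qed.

Lemma indep_factors S S' :
  down_closed C S' -> [disjoint S & S'] -> indep (projected S') (factors S).
Proof.
move=> cS' dS; apply: indepM; first exact: indep_clauses_at.
exact/indep_weights_at/disjoint_projected.
Qed.

Lemma weights_atU (A B t : {set X}) : [disjoint A & B] ->
  weights_at (A :|: B) t = weights_at A t * weights_at B t.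
Proof.
by move=> dAB; rewrite /weights_at -3!big_condT prod_setU_disjoint.
Qed.

Lemma factorsU S S' t : [disjoint S & S'] ->
  factors (S :|: S') t = factors S t * factors S' t.
Proof.
move=> dS; rewrite /factors projectedU weights_atU ?disjoint_projected //.
by rewrite /clauses_at prod_setU_disjoint // mulrACA.
Qed.

Lemma summedU S S' t : down_closed C S -> down_closed C S' ->
  [disjoint S & S'] -> summed (S :|: S') t = summed S t * summed S' t.
Proof.
move=> cS cS' dS; rewrite /summed sumoutM ?disjoint_projected //.
- by rewrite projectedU; apply: eq_sumout => u; apply: factorsU.
- exact: indep_factors.
by apply: indep_factors => //; rewrite disjoint_sym.
Qed.

(** Subtrees at distinct children are disjoint and downward closed, so [summedU] splits them off in
    turn; the empty union contributes 1. *)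
Lemma summed_children n s t : uniq s -> {subset s <= C n} ->
  summed (\bigcup_(o <- s) descendants C o) t =
  \prod_(o <- s) summed (descendants C o) t.
Proof.
elim: s => [|o s IHs] /= => [_ _|/andP[os us] sC].
  rewrite !big_nil /summed.
  have proj0 : projected set0 = set0.
    by apply/setP => x; rewrite inE; apply/projectedP => -[m []]; rewrite inE.
  rewrite proj0 sumout0 /factors proj0 /clauses_at /weights_at.
  by rewrite !big_pred0 ?mulr1 // => x; rewrite inE.
have sC' : {subset s <= C n} by move=> z zs; apply: sC; rewrite inE zs orbT.
rewrite !big_cons summedU ?IHs //.
- exact: down_closed_descendants.
- exact/down_closed_bigcup/down_closed_descendants.
by apply: (disjoint_child_descendants treeC _ sC' os); rewrite sC ?inE ?eqxx.
Qed.

Lemma pbextend_valuation n t :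
  pbextend (valuation C gamma pi W n) t = summed (descendants C n) t.
Proof.
(* Strong induction on the number of descendants, with [k] as a strict bound. *)
move: {2}_.+1 (ltnSn #|descendants C n|) => k.
elim: k n t => // k IHk n t; rewrite ltnS => le_k.
rewrite (valuationE gamma pi W n treeC).
set B := \bigcup_(o <- enum (C n)) descendants C o.
have nB : n \notin B := notin_child_descendants treeC n.
have dnB : [disjoint [set n] & B] by rewrite disjoints1.
have DE : descendants C n = [set n] :|: B := descendantsE C n.
have card_child o : o \in C n -> (#|descendants C o| < k)%N.
  move=> Co; apply: leq_trans le_k; rewrite DE cardsU1 nB ltnS subset_leq_card //.
  by rewrite /B big_enum; apply: bigcup_sup.
case: ifP => Ln.
  have -> : descendants C n = [set n].
    by rewrite DE /B big_enum (eqP Ln) big_set0 setU0.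
  have proj0 : projected [set n] = set0.
    by rewrite /projected big1 // => m; rewrite inE => /andP[/eqP->]; rewrite Ln.
  rewrite /summed proj0 sumout0 /factors proj0 /weights_at big_set0 mulr1.
  by rewrite /clauses_at (big_pred1 n) // => m; rewrite !inE andb_idr // => /eqP->.
have proj1 : projected [set n] = pi n.
  by rewrite /projected (big_pred1 n) // => m; rewrite !inE andb_idr // => /eqP->; rewrite Ln.
have dpi : [disjoint pi n & projected B] by rewrite -proj1 disjoint_projected.
(* For internal [n], the set [[set n]] is not downward closed, so [summedU] does not apply. Instead
   the sum is split by hand: [pi n] outside, the variables projected below [n] inside. *)
rewrite pbextend_projs /summed DE projectedU proj1 sumoutU //.
apply: eq_sumout => u; rewrite pbextend_mul !pbextend_prod.
transitivity (weights_at (pi n) u * summed B u).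
  rewrite mulrC; congr (_ * _).
  rewrite /B (@summed_children n) ?enum_uniq //; last by move=> o; rewrite mem_enum.
  by rewrite big_enum; apply: eq_bigr => o Co; apply/IHk/card_child.
(* The weights of [pi n] ignore the variables projected in [B], so they may enter the inner sum. *)
rewrite -sumout_indepl; last exact: indep_weights_at.
apply: eq_sumout => v; rewrite factorsU //; congr (_ * _).
(* An internal node carries no clause, so only its weights remain. *)
rewrite /factors proj1 /clauses_at big_pred0 ?mul1r // => m.
by rewrite !inE; case: eqP => // ->.
Qed.

Lemma summed_root t : summed (descendants C r) t = weighted_model_count W phi.
Proof.
have -> : descendants C r = [set: T].
  by apply/setP => n; rewrite !inE; apply: root_reaches treeC n.
have projT : projected [set: T] = [set: X].
  rewrite -(pjt_pi_cover pjt); by apply: eq_bigl => n; rewrite inE.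
rewrite /summed projT sumoutT; apply: eq_bigr => u _; rewrite /factors projT.
congr (_ * _); last by rewrite pbextend_prod.
(* The bijection [gamma] turns the product over clauses into one over leaves. *)
rewrite pbextend_prod -(pjt_gamma_im pjt) big_imset //=.
  by apply: eq_bigl => l; rewrite inE.
exact: pjt_gamma_inj pjt.
Qed.

End Valuation.

Theorem theorem2 (R : realType) (X : finType) (phi : cnf X)
  (T : finType) (C : T -> {set T}) (r : T)
  (gamma : T -> clause X) (pi : T -> {set X})
  (W : literal_weights R X)
  (hT : project_join_tree phi C r gamma pi) :
  valuation C gamma pi W r (empty_assignment _)
  = weighted_model_count W phi.
Proof.
(* With every variable summed out, any assignment could be used; [set0] is the one that restricts to
   the empty assignment. *)
rewrite -(summed_root W hT set0) -(pbextend_valuation W hT) /pbextend.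
by congr (valuation C gamma pi W r _); apply: val_inj; rewrite /= set0I.
Qed.
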